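(* Let $(N,E)$ be a network satisfying the standing assumptions. The Shapley value of the path-counting game $v$ on the player set $N^*$ equals $w^*$; that is, the Shapley value of each player $i\in N^*$ in $v$ equals $w_i^*$.
   Context: Network (standing assumptions). $(N,E)$ is a fixed finite directed graph with $|N|\ge 3$ nodes (called agents), $E\subseteq N\times N$; it is connected, has no directed cycles, and has a unique node $s$ (the source) without incoming edges. Let $N_i^+=\{j\in N:(i,j)\in E\}$. A sink is a node with $N_i^+=\emptyset$. A path is a directed path from $s$ to a sink; $\mathcal{P}$ is the (finite) set of paths; $N_P$ is the node set of path $P$. No bottlenecks: for each agent $i$ that is neither the source nor a sink there is $P\in\mathcal{P}$ with $i\notin N_P$. $N^*=\{i\in N:N_i^+\ne\emptyset\}$ is the set of non-sink agents and $N^*_P=N_P\cap N^*$. Weights $w^*$. For $P\in\mathcal{P}$ and $i\in N$ let $v_i(P)=\frac{1}{|N_P^*|\cdot|\mathcal{P}|}$ if $i\in N_P^*$ and $v_i(P)=0$ otherwise; set $w_i^*=\sum_{P\in\mathcal{P}}v_i(P)$. (Thus $w^*_t=0$ for sinks $t$.) Path-counting game. The cooperative (transferable-utility) game $v$ with player set $N^*$ has worth, for each coalition $S\subseteq N^*$, $$v(S)=\frac{|\{P\in\mathcal{P}:N_P^*\subseteq S\}|}{|\mathcal{P}|}.$$ The Shapley value of player $i$ is the expected marginal contribution $v(\mathrm{Pred}_\pi(i)\cup\{i\})-v(\mathrm{Pred}_\pi(i))$ for a uniformly random permutation $\pi$ of $N^*$, where $\mathrm{Pred}_\pi(i)$ is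 the set of players preceding $i$ in $\pi$. *)

(* Defs.v *)
From HB Require Import structures.
From mathcomp Require Import all_boot all_order all_algebra.
Set Implicit Arguments.
Unset Strict Implicit.
Unset Printing Implicit Defensive.
Import Order.TTheory GRing.Theory Num.Theory.

Local Open Scope ring_scope.

Section Network.

Variables (N : finType) (E : rel N).

Definition succs (i : N) : {set N} := [set j | E i j].
Definition preds (i : N) : {set N} := [set j | E j i].

Definition is_sink (i : N) : bool := succs i == set0.
Definition is_source (i : N) : bool := preds i == set0.

(* A directed path has no repeated node; without directed cycles [uniq p]
   already follows from [path E x q]. *)
Definition is_path (s : N) (p : seq N) : bool :=
  if p is x :: q
  then [&& x == s, path E x q, uniq p & is_sink (last x q)]
  else false.

(* Since paths are repetition-free, the length bound #|N| excludes none of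
   them (paths_complete) and only serves to make them range over a finType. *)
Definition paths (s : N) : {set #|N|.-bseq N} := [set P : #|N|.-bseq N | is_path s P].

Lemma paths_complete (s : N) (p : seq N) :
  is_path s p -> exists2 P : #|N|.-bseq N, P \in paths s & p = P :> seq N.
Proof.
move=> pP.
have le_p : (size p <= #|N|)%N.
  case: p pP => [//|x q] /and4P[_ _ uq _].
  by rewrite -(card_uniqP uq) max_card.
by exists (Bseq le_p); rewrite ?inE.
Qed.

Record network (s : N) : Prop := Network {
  network_card : (3 <= #|N|)%N;
  (* connectedness of the underlying undirected graph *)
  network_connected : forall i j : N, connect (fun x y => E x y || E y x) i j;
  network_acyclic : forall (i : N) (p : seq N), ~~ cycle E (i :: p);
  network_source : forall i : N, is_source i <-> i = s;
  network_no_bottleneck : forall i : N, i != s -> ~~ is_sink i ->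
    exists2 P : #|N|.-bseq N, P \in paths s & i \notin P
}.

Definition nonsinks : {set N} := [set i | succs i != set0].

Definition path_nodes (P : seq N) : {set N} := [set i in P].

Definition path_nonsinks (P : seq N) : {set N} := path_nodes P :&: nonsinks.

Definition path_weight (R : realFieldType) (s i : N) (P : seq N) : R :=
  if i \in path_nonsinks P
  then 1 / (#|path_nonsinks P|%:R * #|paths s|%:R)
  else 0.

Definition wstar (R : realFieldType) (s i : N) : R :=
  \sum_(P in paths s) path_weight R s i P.

Definition path_game (R : realFieldType) (s : N) (S : {set N}) : R :=
  #|[set P in paths s | path_nonsinks P \subset S]|%:R / #|paths s|%:R.

End Network.

Section Shapley.

Variables (R : realFieldType) (T : finType).

Definition pred_in (pi : seq T) (i : T) : {set T} :=
  [set j in take (index i pi) pi].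

(* A permutation of the player set A is a duplicate-free listing of A;
   [permutations (enum A)] lists each of them exactly once. Only the values of
   v on subsets of A matter. *)
Definition shapley (A : {set T}) (v : {set T} -> R) (i : T) : R :=
  (\sum_(pi <- permutations (enum A))
     (v (pred_in pi i :|: [set i]) - v (pred_in pi i)))
  / (size (permutations (enum A)))%:R.

End Shapley.

(* Main.v *)
Require Import Defs.
From mathcomp Require Import all_boot all_order all_algebra.
From mathcomp Require Import perm.

(** The path-counting game is the average over the paths [P] of the unanimity
    games on [N_P^*], so by additivity it suffices to compute the Shapley value
    of a unanimity game on a coalition [B]. There the marginal contribution of
    [i] is 1 if [i] is the last member of [B] to arrive and 0 otherwise.
    Exchanging two members of [B] permutes the orderings, so all members
    are last equally often, hence with probability [1 / #|B|] each. *)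

Set Implicit Arguments.
Unset Strict Implicit.
Unset Printing Implicit Defensive.
Import GRing.Theory Num.Theory.

Local Open Scope ring_scope.

Section ShapleyLinear.

Variables (R : realFieldType) (T : finType).
Implicit Types (A B S : {set T}) (v : {set T} -> R).

Lemma eq_shapley A v v' i : v =1 v' -> shapley A v i = shapley A v' i.
Proof.
by move=> eq_v; rewrite /shapley; under eq_bigr do rewrite !eq_v.
Qed.

Lemma shapleyZ A v a i : shapley A (fun S => a * v S) i = a * shapley A v i.
Proof.
rewrite /shapley mulrA mulr_sumr.
by under eq_bigr do rewrite -mulrBr.
Qed.

Lemma shapley_sum (I : finType) (P : {pred I}) A (v : I -> {set T} -> R) i :
  shapley A (fun S => \sum_(k in P) v k S) i = \sum_(k in P) shapley A (v k) i.
Proof.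
rewrite /shapley -mulr_suml exchange_big /=.
by under eq_bigr do rewrite -sumrB.
Qed.

End ShapleyLinear.

Section Unanimity.

Variables (R : realFieldType) (T : finType).
Implicit Types (A B S : {set T}) (pi : seq T).

(** The inequality is weak so that [j = i] needs no exception; on a listing that contains [B], a tie
    with [i] occurs only there. *)
Definition last_in B pi i : bool := [forall j in B, index j pi <= index i pi]%N.

Lemma mem_pred_in pi i j :
  (j \in pred_in pi i) = (index j pi < index i pi)%N.
Proof. by rewrite inE in_take_leq ?index_size. Qed.

(** A member [i] of [B] never precedes itself, so only the first indicator can be 1, and it is 1
    when the rest of [B] comes before [i]. An outsider does not affect whether [B] is covered. *)
Lemma unanimity_marginal B pi i : {subset B <= pi} ->
  ((B \subset pred_in pi i :|: [set i])%:R - (B \subset pred_in pi i)%:R : R)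
  = ((i \in B) && last_in B pi i)%:R.
Proof.
move=> sBpi; have [iB|iNB] /= := boolP (i \in B).
  have -> : (B \subset pred_in pi i) = false.
    by apply/negP => /subsetP/(_ _ iB); rewrite mem_pred_in ltnn.
  rewrite subr0; congr (nat_of_bool _)%:R; apply/subsetP/forall_inP => lastB j jB.
    move: (lastB _ jB); rewrite in_setU mem_pred_in in_set1.
    by case/orP=> [/ltnW|/eqP->].
  rewrite in_setU mem_pred_in in_set1 ltn_neqAle lastB // andbT.
  have [->|jNi] := eqVneq j i; first by rewrite orbT.
  by rewrite orbF; apply: contra jNi => /eqP/(index_inj i (sBpi _ jB) (sBpi _ iB))->.
suff -> : (B \subset pred_in pi i :|: [set i]) = (B \subset pred_in pi i).
  by rewrite subrr.
apply/subsetP/subsetP => sB j jB; have := sB j jB; rewrite in_setU ?in_set1.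
  by case/orP=> // /eqP ji; rewrite -ji jB in iNB.
by move=> ->.
Qed.

(** The member of [B] with the largest index is last, and [index] is injective on the entries of
    [pi], so no other member is. The element [b] only witnesses that [B] is nonempty. *)
Lemma sum_last_in B pi b : {subset B <= pi} -> b \in B ->
  \sum_(i in B) (last_in B pi i)%:R = 1 :> R.
Proof.
move=> sBpi bB; case: (arg_maxnP (index^~ pi) bB) => m mB maxm.
rewrite (bigD1 m) //= big1 => [|i /andP[iB iNm]].
  by rewrite addr0; have -> : last_in B pi m by apply/forall_inP.
have [lasti|//] := boolP (last_in B pi i); case/eqP: iNm.
apply: (index_inj i (sBpi _ iB) (sBpi _ mB)).
apply/eqP; rewrite eqn_leq; apply/andP; split; first exact: maxm.
exact: (forall_inP lasti).
Qed.

(** Relabelling by [f] is an injection of a finite duplicate-free list into itself, hence a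
    rearrangement of it. This justifies reindexing sums over orderings. *)
Lemma map_perm_permutations (f : {perm T}) A :
  {in A, forall x, f x \in A} ->
  perm_eq (map (map f) (permutations (enum A))) (permutations (enum A)).
Proof.
move=> fA; have inj_f : injective (map f) by apply/inj_map/perm_inj.
have sub : {subset map (map f) (permutations (enum A)) <= permutations (enum A)}.
  move=> _ /mapP[pi + ->]; rewrite !mem_permutations => piA.
  apply: uniq_perm; rewrite ?enum_uniq ?(map_inj_uniq (@perm_inj _ f)) //.
    by rewrite (perm_uniq piA) enum_uniq.
  have sub_pi : {subset map f pi <= enum A}.
    move=> _ /mapP[x + ->]; rewrite (perm_mem piA) !mem_enum; exact: fA.
  (* Pigeonhole: a duplicate-free list inside [enum A] of the same length has the same members. *)
  apply: (uniq_min_size _ sub_pi _).2.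
    by rewrite (map_inj_uniq (@perm_inj _ f)) (perm_uniq piA) enum_uniq.
  by rewrite size_map (perm_size piA).
have uniq_img : uniq (map (map f) (permutations (enum A))).
  by rewrite map_inj_uniq // permutations_uniq.
apply: uniq_perm => //; first exact: permutations_uniq.
by apply: (uniq_min_size uniq_img sub _).2; rewrite size_map.
Qed.

(** Swapping [i] and [j] preserves both [A] and [B], and matches the orderings where [i] is last
    with those where [j] is last. *)
Lemma last_in_sym A B i j : B \subset A -> i \in B -> j \in B ->
  \sum_(pi <- permutations (enum A)) (last_in B pi i)%:R
  = \sum_(pi <- permutations (enum A)) (last_in B pi j)%:R :> R.
Proof.
move=> /subsetP sBA iB jB; set f := tperm i j.
have fS (S : {set T}) : i \in S -> j \in S -> {in S, forall x, f x \in S}.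
  by move=> iS jS x xS; rewrite /f; case: tpermP.
have fA := fS A (sBA _ iB) (sBA _ jB).
rewrite -[RHS](perm_big _ (map_perm_permutations fA)) big_map.
apply: eq_bigr => pi _; congr (nat_of_bool _)%:R.
have idx x : index (f x) (map f pi) = index x pi by apply/index_map/perm_inj.
rewrite /last_in -(tpermL i j) -/f idx.
(* The bound variable is reindexed by [f], an involution of [B]. *)
apply/forall_inP/forall_inP => lasti k kB; last by rewrite -idx lasti ?fS.
by rewrite -(tpermK i j k) -/f idx lasti ?fS.
Qed.

Lemma shapley_unanimity A B i : B \subset A ->
  shapley A (fun S => (B \subset S)%:R : R) i
  = if i \in B then #|B|%:R^-1 else 0.
Proof.
move=> sBA; set ps := permutations (enum A).
have sBps pi : pi \in ps -> {subset B <= pi}.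
  rewrite mem_permutations => piA x xB.
  by rewrite (perm_mem piA) mem_enum (subsetP sBA).
have -> : shapley A (fun S => (B \subset S)%:R : R) i
    = (\sum_(pi <- ps) ((i \in B) && last_in B pi i)%:R) / (size ps)%:R.
  (* [big_seq] keeps the membership [pi \in ps], which gives the inclusion of [B] in [pi]. *)
  rewrite /shapley; congr (_ / _); rewrite [LHS]big_seq [RHS]big_seq.
  by apply: eq_bigr => pi /sBps; apply: unanimity_marginal.
have [iB|_] /= := ifP; last by rewrite big1_eq mul0r.
have ps0 : (size ps)%:R != 0 :> R.
  rewrite pnatr_eq0 size_eq0; apply/eqP => ps0.
  by have := mem_permutations (enum A) (enum A); rewrite -/ps ps0 perm_refl.
have B0 : #|B|%:R != 0 :> R.
  by rewrite pnatr_eq0 -lt0n; apply/card_gt0P; exists i.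
(* Double counting: each ordering has exactly one last member of [B]. *)
have total : \sum_(j in B) \sum_(pi <- ps) (last_in B pi j)%:R = (size ps)%:R :> R.
  rewrite exchange_big /= big_seq.
  under eq_bigr => pi /sBps sBpi do rewrite (sum_last_in sBpi iB).
  by rewrite -big_seq big_const_seq count_predT iter_addr_0.
(* After clearing denominators, [#|B|] copies of the count for [i] must equal [total], which follows
   term by term from symmetry. *)
apply: (mulfI B0); rewrite mulrA divff //; apply: (canLR (mulfK ps0)).
rewrite mul1r -total mulr_natl -sumr_const.
by apply: eq_bigr => j jB; apply: last_in_sym.
Qed.

End Unanimity.

Lemma path_game_unanimity (R : realFieldType) (N : finType) (E : rel N) (s : N) :
  path_game E R s =1 fun S => #|paths E s|%:R^-1 *
    \sum_(P in paths E s) (path_nonsinks E P \subset S)%:R.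
Proof.
move=> S; rewrite /path_game mulrC -natr_sum -sum1dep_card big_mkcondr.
by congr (_ * _%:R); apply: eq_bigr => P _; case: (_ \subset _).
Qed.

Theorem theorem2 (R : realFieldType) (N : finType) (E : rel N) (s : N)
    (hN : network E s) (i : N) (hi : i \in nonsinks E) :
  shapley (nonsinks E) (path_game E R s) i = wstar E R s i.
Proof.
rewrite (eq_shapley _ _ (@path_game_unanimity R N E s)) shapleyZ shapley_sum.
(* [wstar] sums over the same paths, so the comparison is path by path. *)
rewrite mulr_sumr; apply: eq_bigr => P _.
rewrite shapley_unanimity ?subsetIr // /path_weight.
by case: ifP => _; rewrite ?mulr0 // div1r invfM mulrC.
Qed.
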